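(* Let $m\ge 2$ and $n\ge 1$ be integers and let $B_m^n=\{z\in\mathbb{C}^n : z_i^m=1 \text{ for } i=1,\dots,n\}$. Let $f:B_m^n\to\mathbb{R}$ be a nonnegative polynomial such that $$f\in\operatorname{span}\bigl(\{z^\alpha : \alpha\in\{0,\dots,m-1\}^n,\ |\{i:\alpha_i\ne 0\}|\le 2\}\bigr).$$ Then $f=\sum_{j=1}^r g_j\bar g_j$ on $B_m^n$, where each $g_j$ is supported on $$\mathcal{M}(\lfloor n/2\rfloor+1)=\{z^\alpha : \alpha\in\{0,\dots,m-1\}^n,\ n_j(\alpha)\le\lfloor n/2\rfloor+1\ \text{ for all } 1\le j\le m-1\}.$$
   Context: For $\alpha\in\{0,\dots,m-1\}^n$, $z^\alpha=\prod_{i=1}^n z_i^{\alpha_i}$, regarded as a function on $B_m^n$, and for $1\le j\le m-1$, $n_j(\alpha)=|\{i\in\{1,\dots,n\}:\alpha_i=j\}|$ is the number of variables with exponent $j$. The span is over $\mathbb{C}$, as functions on $B_m^n$; nonnegative means $f(z)\ge 0$ for all $z\in B_m^n$. The $g_j$ are complex-valued functions on $B_m^n$, and $\bar g_j$ is the pointwise complex conjugate. A function on $B_m^n$ is supported on a set of monomials if it is a complex linear combination of monomials in that set. *)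

(* Defs.v *)
From mathcomp Require Import all_boot all_order all_algebra.
From mathcomp Require Import reals complex.

Set Implicit Arguments.
Unset Strict Implicit.
Unset Printing Implicit Defensive.

Import Order.TTheory GRing.Theory Num.Theory.

Local Open Scope ring_scope.
Local Open Scope complex_scope.

Definition unit_roots_power (R : realType) (m n : nat) : Type :=
  {z : {ffun 'I_n -> R[i]} | [forall i, z i ^+ m == 1]}.

Notation exponent m n := {ffun 'I_n -> 'I_m}.

Definition monomial (R : realType) (m n : nat) (alpha : exponent m n)
    (z : unit_roots_power R m n) : R[i] :=
  \prod_(i < n) (val z i) ^+ alpha i.

(* A set of monomials is given by the set [A] of their exponents. *)
Definition supported_on (R : realType) (m n : nat) (A : {set exponent m n})
    (g : unit_roots_power R m n -> R[i]) : Prop :=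
  exists c : exponent m n -> R[i],
    forall z, g z = \sum_(alpha in A) c alpha * monomial alpha z.

Definition exponent_count (m n : nat) (j : nat) (alpha : exponent m n) : nat :=
  #|[set i | alpha i == j :> nat]|.

Definition at_most_two_variables (m n : nat) : {set exponent m n} :=
  [set alpha : exponent m n | #|[set i | alpha i != 0%N :> nat]| <= 2]%N.

(* [j : 'I_m] with [0 < j] ranges over the nonzero exponents 1, ..., m - 1. *)
Definition bounded_counts (m n d : nat) : {set exponent m n} :=
  [set alpha : exponent m n |
    [forall j : 'I_m, (0 < j)%N ==> (exponent_count j alpha <= d)%N]].

(* Main.v *)
Require Import Defs.
From mathcomp Require Import all_boot all_order all_algebra.
From mathcomp Require Import cyclic separable cyclotomic.
From mathcomp Require Import reals complex.
From mathcomp Require Import ring zify.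
Import Order.TTheory GRing.Theory Num.Theory.
Local Open Scope ring_scope.
Local Open Scope complex_scope.
Set Implicit Arguments.
Unset Strict Implicit.

(** The vertices of a graph on the exponents (Z/m)^n are the monomials z^a, and
    two of them are adjacent when they differ in at most two variables.  With
    N = m^n, consider the kernel
      K(a, b) = sum over the points t of f(t) conj(t^a) t^b.
    Since f >= 0, it is the Gram matrix of the vectors (sqrt(f(t)) t^a)_t; by
    orthogonality of characters, and because f only involves monomials in at
    most two variables, K(a, b) vanishes unless a and b are adjacent or equal.
    Fourier inversion recovers f from K:
      N^2 f(s) = sum_(a, b) K(a, b) s^a conj(s^b)
    ([gram_reconstruction]).  Hence any factorization
    K(a, b) = sum_v conj(g_v(a)) g_v(b) gives
      f(s) = sum_v |N^-1 sum_a conj(g_v(a)) s^a|^2,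
    and it remains to find one where every g_v is supported on a translate of
    the set of exponents to which the squares are restricted: translating all exponents by a constant multiplies
    the v-th sum by a monomial of modulus one, which does not change its
    squared modulus.

    Such a factorization comes from eliminating the vertices one at a time
    (Gram-Schmidt, or sparse Cholesky).  Eliminating v produces a g_v supported
    on v and its current neighbours, and makes these neighbours pairwise
    adjacent.  No further edge appears if the graph is first enlarged to a
    graph in which the neighbours of v yet to be eliminated already form a
    clique ([sparse_gram_schmidt]).

    Let d = floor(n/2) + 1, so that n < 2d, and let n_j(a) be the number of
    coordinates of a equal to j, now with j = 0 allowed.  Call an exponent a
    balanced if all its n_j(a) are at most d.  Two distinct values cannot both
    occur at least d times, so an unbalanced exponent has one dominant value.
    The enlarged graph joins any two balanced exponents, and joins a to b if,
    for some j, n_j exceeds d on one of them and n_j(a), n_j(b) differ by at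
    most 2.  Vertices are eliminated by decreasing max_j n_j.  For v with
    dominant value j, its neighbours all have n_j >= n_j(v) - 2 >= d - 1
    ([linked_dominant]), which makes the later ones pairwise adjacent
    ([linked_perfect]).  Moreover at most n - (d - 1) <= d of their
    coordinates differ from j: translating j to 0 puts them all in the set of
    exponents whose nonzero values each occur at most d times
    ([linked_rotate]). *)

(** * Sparse Gram-Schmidt orthogonalization *)

Definition inner (C : numClosedFieldType) (W : finType) (x y : W -> C) : C :=
  \sum_t (x t)^*%R * y t.

Section Elimination.
Variables (C : numClosedFieldType) (W : finType).
Implicit Types x y u : W -> C.

Lemma inner_conj x y : (inner x y)^*%R = inner y x.
Proof.
rewrite /inner rmorph_sum; apply: eq_bigr => t _.
by rewrite rmorphM /= conjCK mulrC.
Qed.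

Lemma inner_self_eq0 x : inner x x = 0 -> forall t, x t = 0.
Proof.
rewrite /inner => h t; have := psumr_eq0P _ h (i := t) isT.
rewrite mulrC -normCK => h0; apply/normr0_eq0/eqP; rewrite -sqrf_eq0 h0 //.
by move=> s _; rewrite mulrC -normCK exprn_ge0.
Qed.

Lemma inner_self_ge0 x : 0 <= inner x x.
Proof. by apply: sumr_ge0 => t _; rewrite mulrC mul_conjC_ge0. Qed.

Lemma inner_isotropic u x : inner u u = 0 -> inner u x = 0.
Proof.
by move=> /inner_self_eq0 u0; apply: big1 => t _; rewrite u0 conjC0 mul0r.
Qed.

(** When [u] is isotropic, hence zero, the convention [x / 0 = 0] makes this the
    identity, so that [inner_project_off] holds for every [u]. *)
Definition project_off u x : W -> C :=
  fun t => x t - inner u x / inner u u * u t.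

(** The Gram matrix of the projected vectors is the Schur complement of the
    original one. *)
Lemma inner_project_off u x y :
  inner (project_off u x) (project_off u y)
  = inner x y - inner x u * inner u y / inner u u.
Proof.
have expand c d : inner (fun t => x t - c * u t) (fun t => y t - d * u t)
    = inner x y - d * inner x u - c^*%R * inner u y + c^*%R * d * inner u u.
  rewrite /inner !mulr_sumr -!sumrB -big_split /=; apply: eq_bigr => t _.
  by rewrite rmorphB rmorphM /=; ring.
rewrite /project_off expand rmorphM /= fmorphV /= !inner_conj.
have [-> | nz] := eqVneq (inner u u) 0; first by rewrite invr0; ring.
by field.
Qed.

End Elimination.

(** Cholesky factorization without fill-in of a Gram matrix whose nonzero
    entries are edges of [E].  Vertices are eliminated by decreasing weight; the
    new entries created by eliminating [v] lie between neighbours of [v] of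
    at most its weight, and [peo] says that those are already edges.  Allowing
    the matrix to be supported on a subset [S] is what lets the elimination
    proceed by induction, as a projected vector is orthogonal to the eliminated
    one. *)
Lemma sparse_gram_schmidt (C : numClosedFieldType) (V W : finType)
    (E : rel V) (wt : V -> nat)
    (peo : forall v a b, (wt a <= wt v)%N -> (wt b <= wt v)%N ->
             E v a -> E v b -> E a b)
    (S : {set V}) (U : V -> W -> C) :
  (forall a b, inner (U a) (U b) != 0 -> [&& a \in S, b \in S & E a b]) ->
  exists g : V -> V -> C,
    (forall v a, g v a != 0 -> (wt a <= wt v)%N && E v a) /\
    (forall a b, inner (U a) (U b) = \sum_(v in S) (g v a)^*%R * g v b).
Proof.
elim: {S}_.+1 {-2}S (ltnSn #|S|) U => // k IH S ltSk U sparse.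
have [S0 | [v0 v0S]] := set_0Vmem S.
  exists (fun _ _ => 0); split=> [v a | a b]; first by rewrite eqxx.
  rewrite S0 big_set0; apply/eqP/negPn/negP => /sparse.
  by rewrite S0 inE.
have [v] := arg_maxnP wt v0S; rewrite -/(v \in S) => vS v_max.
pose u := U v; pose s := sqrtC (inner u u).
pose U' a := project_off u (U a).
have sparse' a b : inner (U' a) (U' b) != 0 ->
    [&& a \in S :\ v, b \in S :\ v & E a b].
  (* The vector [U' v] vanishes, so row and column [v] are now zero. *)
  have neq_v (c d : V) : inner (U' c) (U' d) != 0 -> c != v.
    rewrite inner_project_off; apply: contraNneq => ->; apply/eqP.
    have [u0 | u0] := eqVneq (inner u u) 0; last by rewrite -/u; field.
    by rewrite -/u !(inner_isotropic _ u0) mulr0 mul0r subr0.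
  move=> nz; have av := neq_v _ _ nz.
  have bv : b != v by apply: neq_v (a) _; rewrite -inner_conj conjC_eq0.
  rewrite !inE av bv /=.
  (* An entry that was zero before is a fill-in between neighbours of [v]. *)
  have [ab0 | ab_nz] := eqVneq (inner (U a) (U b)) 0; last exact: sparse.
  move: nz; rewrite inner_project_off ab0 sub0r oppr_eq0 !mulf_eq0 !negb_or.
  case/andP=> /andP[nzav nzvb] _; have /and3P[_ bS Evb] := sparse _ _ nzvb.
  have /sparse/and3P[_ aS Eva] : inner u (U a) != 0.
    by rewrite -inner_conj conjC_eq0.
  by rewrite aS bS /=; apply: (peo v) => //; apply: v_max.
have [|g [g_supp g_sum]] := IH (S :\ v) _ U' sparse'.
  by move: ltSk; rewrite (cardsD1 v) vS.
exists (fun x a => if x == v then inner u (U a) / s else g x a); split.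
  move=> x a; case: (x =P v) => [-> | _]; last exact: g_supp.
  rewrite mulf_eq0 negb_or => /andP[/sparse/and3P[_ aS ->] _].
  by rewrite andbT; apply: v_max.
move=> a b; rewrite (big_setD1 v) //= eqxx.
rewrite (eq_bigr (fun x => (g x a)^*%R * g x b)); last first.
  by move=> x; rewrite !inE; case: eqP.
rewrite -g_sum inner_project_off rmorphM fmorphV /= inner_conj.
rewrite (geC0_conj (x := s)) ?sqrtC_ge0 ?inner_self_ge0 // mulrACA -invfM.
by rewrite -expr2 sqrtCK addrC subrK.
Qed.

(** * A chordal graph on the exponents *)

Section Counts.
Variables (n p d : nat).
Let m := p.+1.
Hypothesis n_lt : (n < d.*2)%N.
Implicit Types a b v : exponent m n.

Definition max_count a := (\max_(j < m) exponent_count j a)%N.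

Lemma exponent_count_le_max (j : 'I_m) a :
  (exponent_count j a <= max_count a)%N.
Proof. exact: (leq_bigmax (F := fun j : 'I_m => exponent_count j a)). Qed.

Lemma max_count_leP a k :
  reflect (forall j : 'I_m, exponent_count j a <= k)%N (max_count a <= k)%N.
Proof.
apply: (iffP (bigmax_leqP _ _ _)) => h j; first exact: h.
by move=> _; apply: h.
Qed.

Lemma max_count_attained a : exists j : 'I_m, max_count a = exponent_count j a.
Proof.
have [|j maxE] := bigop.eq_bigmax (fun j : 'I_m => exponent_count j a).
  by rewrite card_ord.
by exists j; rewrite -maxE.
Qed.

Lemma exponent_countD_le (i j : 'I_m) a :
  i != j -> (exponent_count i a + exponent_count j a <= n)%N.
Proof.
move=> ij; rewrite -cardsUI [X in (_ + X)%N](_ : _ = 0%N).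
  by rewrite addn0 (leq_trans (max_card _)) ?card_ord.
apply/eqP; rewrite cards_eq0; apply/eqP/setP=> x; rewrite !inE.
apply/andP=> -[/eqP e1 /eqP e2]; case/eqP: ij.
by apply: val_inj; rewrite /= -e1 -e2.
Qed.

(** A graph containing all pairs of exponents at Hamming distance at most 2, for
    which decreasing [max_count] is a perfect elimination ordering.  The balanced
    exponents ([max_count] at most [d]) form one big clique; around it, each
    value [j] has an arm of exponents dominated by [j], layered by
    [exponent_count j], in which layers at distance at most 2 are joined.  As
    [d < maxn _ _] only asks for one dominated end, the arms are attached to
    the clique. *)
Definition linked : rel (exponent m n) := fun a b =>
  ((max_count a <= d) && (max_count b <= d))%N ||
  [exists j : 'I_m,
    [&& (d < maxn (exponent_count j a) (exponent_count j b))%N,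
      (exponent_count j a <= exponent_count j b + 2)%N &
      (exponent_count j b <= exponent_count j a + 2)%N]].

(** Only an edge along the arm of [j] can leave a vertex dominated by [j]:
    [exponent_count i v <= n - (d + 1) <= d - 2] for every other value [i], and
    an edge along the arm of [i] would require a jump by more than 2. *)
Lemma linked_dominant (j : 'I_m) v a :
  (d < exponent_count j v)%N -> linked v a ->
  (exponent_count j v <= exponent_count j a + 2)%N.
Proof.
move=> jv; have := exponent_count_le_max j v.
move=> jmax /orP[/andP[] | /existsP[i /and3P[]]]; first by lia.
have [-> // | ij] := eqVneq i j; have := exponent_countD_le v ij; lia.
Qed.

(** If [v] is dominated by [j], then [a] and [b] lie on the layer of [v] in its
    arm or on one of the two layers below.  Either one of them is still
    dominated by [j], and they are joined by the arm, or [exponent_count j] is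
    [d - 1] or [d] on both: this leaves at most [n - (d - 1) <= d] coordinates
    for any other value, so both are balanced. *)
Lemma linked_perfect v a b :
  (max_count a <= max_count v)%N -> (max_count b <= max_count v)%N ->
  linked v a -> linked v b -> linked a b.
Proof.
move=> av bv va vb; have [vd | dv] := leqP (max_count v) d.
  by rewrite /linked (leq_trans av) // (leq_trans bv).
have [j vj] := max_count_attained v; rewrite vj in av bv dv.
have ja := linked_dominant dv va; have jb := linked_dominant dv vb.
have maja := exponent_count_le_max j a; have majb := exponent_count_le_max j b.
have small c : (exponent_count j v <= exponent_count j c + 2)%N ->
    (exponent_count j c <= d)%N -> (max_count c <= d)%N.
  move=> jc jcd; apply/max_count_leP=> i; have [-> // | ij] := eqVneq i j.
  by have := exponent_countD_le c ij; lia.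
have [abd | dab] := leqP (maxn (exponent_count j a) (exponent_count j b)) d.
  by rewrite /linked !small //; lia.
apply/orP; right; apply/existsP; exists j; rewrite dab /=; lia.
Qed.

Lemma linked_hamming a b :
  (#|[set i | a i != b i]| <= 2)%N -> linked a b.
Proof.
move=> ab2.
have near (c c' : exponent m n) (j : 'I_m) :
    (#|[set i | c i != c' i]| <= 2)%N ->
    (exponent_count j c <= exponent_count j c' + 2)%N.
  move=> h; apply: leq_trans (leq_add (leqnn _) h).
  apply: leq_trans (leq_card_setU _ _); apply: subset_leq_card.
  apply/subsetP=> i; rewrite !inE.
  by case: (c i =P c' i) => [->|]; rewrite ?orbT // orbF.
have ba2 : (#|[set i | b i != a i]| <= 2)%N.
  apply: leq_trans ab2; apply/subset_leq_card/subsetP=> i.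
  by rewrite !inE eq_sym.
rewrite /linked; case: (leqP (max_count a) d) => [ad | da] /=.
  case: (leqP (max_count b) d) => [// | db] /=.
  have [j bj] := max_count_attained b; apply/existsP; exists j.
  by rewrite !near // leq_max -bj db orbT.
have [j aj] := max_count_attained a; apply/existsP; exists j.
by rewrite !near // leq_max -aj da.
Qed.

(** The subtraction is that of the group [Z/m] carried by ['I_m]: the value [j]
    is moved to 0. *)
Definition rotate_exponent (j : 'I_m) a : exponent m n := [ffun i => a i - j].

(** For balanced [v] nothing has to be moved.  For [v] dominated by [j], at
    least [d - 1] coordinates are moved to 0, and the at most
    [n - (d - 1) <= d] others are the only ones which can be nonzero. *)
Lemma linked_rotate v : exists j : 'I_m, forall a,
  (max_count a <= max_count v)%N -> linked v a ->
  rotate_exponent j a \in bounded_counts m n d.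
Proof.
have [vd | dv] := leqP (max_count v) d.
  exists 0 => a av _; rewrite inE; apply/forallP => l; apply/implyP => _.
  rewrite (_ : rotate_exponent 0 a = a); last first.
    by apply/ffunP=> i; rewrite ffunE subr0.
  exact: leq_trans (exponent_count_le_max l a) (leq_trans av vd).
have [j vj] := max_count_attained v; exists j => a _ va.
rewrite vj in dv; have ja := linked_dominant dv va.
rewrite inE; apply/forallP => l; apply/implyP => l_gt0.
suff : (exponent_count l (rotate_exponent j a) + exponent_count j a <= n)%N.
  by lia.
rewrite -cardsUI [X in (_ + X)%N](_ : _ = 0%N).
  by rewrite addn0 (leq_trans (max_card _)) ?card_ord.
apply/eqP; rewrite cards_eq0; apply/eqP/setP=> i; rewrite !inE ffunE.
apply/andP=> -[/eqP e1 /eqP/val_inj e2]; move: l_gt0.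
by rewrite -e1 e2 subrr.
Qed.

End Counts.

(** * Monomials on the product of roots of unity *)

Section Monomials.
Variables (R : realType) (n p : nat).
Let m := p.+1.
Implicit Types (a b : exponent m n) (z : unit_roots_power R m n).

Lemma unit_roots_powerP z i : val z i ^+ m = 1.
Proof. by apply/eqP; have /forallP := valP z. Qed.

Lemma root_of_unity_conj (x : R[i]) : x ^+ m = 1 -> x * x^*%R = 1.
Proof.
move=> xm; rewrite -normCK; suff -> : `|x| = 1 by rewrite expr1n.
by apply/eqP; rewrite -(@pexpr_eq1 _ _ m) // -normrX xm normr1.
Qed.

Lemma monomial_conj a z : monomial a z * (monomial a z)^*%R = 1.
Proof.
rewrite /monomial rmorph_prod -big_split big1 //= => i _.
by rewrite root_of_unity_conj // exprAC unit_roots_powerP expr1n.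
Qed.

Lemma monomial_rotate (j : 'I_m) a z :
  monomial a z = monomial (rotate_exponent j a) z * monomial [ffun=> j] z.
Proof.
rewrite /monomial -big_split; apply: eq_bigr => i _ /=; rewrite !ffunE -exprD.
by rewrite -(expr_mod (_ + _) (unit_roots_powerP z i)) -[in LHS](subrK j (a i)).
Qed.

(** Multiplying by the conjugate of the monomial with constant exponent [j], of
    modulus one, translates the support by the constant [-j]. *)
Lemma supported_on_rotate (A : {set exponent m n}) (j : 'I_m)
    (g : exponent m n -> R[i]) :
  (forall a, g a != 0 -> rotate_exponent j a \in A) ->
  supported_on A (fun z : unit_roots_power R m n =>
    (monomial [ffun=> j] z)^*%R * \sum_a g a * monomial a z).
Proof.
move=> gA.
exists (fun b => \sum_(a | (g a != 0) && (rotate_exponent j a == b)) g a).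
move=> z; rewrite (bigID (fun a => g a != 0)) /= [X in _ + X]big1 ?addr0.
  rewrite mulr_sumr (partition_big (rotate_exponent j) (mem A)) //=.
  apply: eq_bigr => b _; rewrite mulr_suml.
  apply: eq_bigr => a /andP[_ /eqP <-].
  rewrite (monomial_rotate j a z) mulrCA [_^*%R * _]mulrC -mulrA.
  by rewrite monomial_conj mulr1.
by move=> a /negPn/eqP ->; rewrite mul0r.
Qed.

(** The sum factors into one geometric sum per coordinate. *)
Lemma character_sum (zeta : 'I_n -> R[i]) :
  (forall i, zeta i ^+ m = 1) ->
  \sum_(a : exponent m n) \prod_i zeta i ^+ a i
  = (m ^ n)%:R *+ [forall i, zeta i == 1].
Proof.
move=> zm; rewrite -(bigA_distr_bigA (fun i (k : 'I_m) => zeta i ^+ k)) /=.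
case: forallP => [z1 | nz1].
  rewrite (eq_bigr (fun=> m%:R)); first by rewrite prodr_const card_ord natrX.
  move=> i _; rewrite (eqP (z1 i)) (eq_bigr (fun=> 1)) => [|k _].
    by rewrite sumr_const card_ord.
  by rewrite expr1n.
have /existsP[i zi] : [exists i, zeta i != 1].
  by rewrite -negb_forall; apply/forallP.
rewrite (bigD1 i) //= [X in X * _](_ : _ = 0) ?mul0r //.
have /eqP := subrX1 (zeta i) m; rewrite zm subrr eq_sym mulf_eq0 subr_eq0.
by rewrite (negPf zi) => /eqP.
Qed.

Lemma primitive_root_exists : exists w : R[i], m.-primitive_root w.
Proof.
pose q : {poly R[i]} := 'X^m - 1; have [r Dq] := closed_field_poly_normal q.
rewrite (monicP _) ?monicXnsubC // scale1r in Dq.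
have rm1 : all m.-unity_root r by apply/allP=> z; rewrite -root_prod_XsubC -Dq.
have sz_r : (m < (size r).+1)%N.
  by rewrite -(size_prod_XsubC r id) -Dq size_XnsubC.
have [|w] := hasP (has_prim_root (ltn0Sn p) rm1 _ sz_r); last by exists w.
by rewrite -separable_prod_XsubC -Dq separable_Xn_sub_1 // pnatr_eq0.
Qed.

Variables (w : R[i]) (w_prim : m.-primitive_root w).

Lemma root_power_order k : (w ^+ k) ^+ m = 1.
Proof. by rewrite exprAC (prim_expr_order w_prim) expr1n. Qed.

Lemma point_proof b : [forall i, [ffun i : 'I_n => w ^+ b i] i ^+ m == 1].
Proof. by apply/forallP=> i; rewrite ffunE root_power_order. Qed.

(** Powers of a primitive root label the points by the exponents themselves; this
    makes sums over the points finite sums over [exponent m n], and the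
    monomials a symmetric matrix, so that one orthogonality relation serves
    for points and for exponents. *)
Definition point b : unit_roots_power R m n :=
  exist _ [ffun i : 'I_n => w ^+ b i] (point_proof b).

Lemma point_surj z : exists b, z = point b.
Proof.
have log i : exists k : 'I_m, val z i == w ^+ k.
  by have [k ->] := prim_rootP w_prim (unit_roots_powerP z i); exists k.
exists [ffun i => xchoose (log i)]; apply: val_inj; apply/ffunP=> i.
by rewrite !ffunE; apply/eqP/(xchooseP (log i)).
Qed.

Lemma monomial_point a b : monomial a (point b) = \prod_i (w ^+ a i) ^+ b i.
Proof. by apply: eq_bigr => i _; rewrite ffunE exprAC. Qed.

Lemma monomial_point_sym a b : monomial a (point b) = monomial b (point a).
Proof. by rewrite monomial_point; apply: eq_bigr => i _; rewrite ffunE. Qed.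

Lemma root_power_conj k : w ^+ k * (w ^+ k)^*%R = 1.
Proof. by rewrite root_of_unity_conj ?root_power_order. Qed.

Lemma root_power_inj (k l : 'I_m) : w ^+ k * (w ^+ l)^*%R = 1 -> k = l.
Proof.
move=> /(congr1 (fun x => x * w ^+ l)).
rewrite mul1r -mulrA [_^*%R * _]mulrC root_power_conj mulr1 => /eqP.
by rewrite (eq_prim_root_expr w_prim) !modn_small // => /eqP/val_inj.
Qed.

Lemma monomial_sum_exponents b b' :
  \sum_a monomial a (point b) * (monomial a (point b'))^*%R
  = (m ^ n)%:R *+ (b == b').
Proof.
have -> : (b == b') = [forall i, w ^+ b i * (w ^+ b' i)^*%R == 1].
  apply/eqP/forallP => [-> i | h]; first by rewrite root_power_conj.
  by apply/ffunP=> i; apply/root_power_inj/eqP.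
rewrite -character_sum => [|i]; last first.
  by rewrite exprMn -rmorphXn /= !root_power_order rmorph1 mulr1.
apply: eq_bigr => a _; rewrite !(monomial_point_sym a) !monomial_point.
rewrite rmorph_prod /= -big_split.
by apply: eq_bigr => i _; rewrite exprMn rmorphXn.
Qed.

(** The summand is the character of exponent [c + b - a], whose sum vanishes
    unless this exponent is zero. *)
Lemma monomial_triple_sum a b c :
  \sum_t monomial c (point t) *
    ((monomial a (point t))^*%R * monomial b (point t)) != 0 ->
  forall i, c i = 0 -> a i = b i.
Proof.
rewrite (eq_bigr (fun t : exponent m n => \prod_i
  (w ^+ c i * ((w ^+ a i)^*%R * w ^+ b i)) ^+ t i)); last first.
  move=> t _; rewrite !monomial_point rmorph_prod /= -!big_split /=.
  by apply: eq_bigr => i _; rewrite !exprMn rmorphXn.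
rewrite character_sum => [|i]; last first.
  by rewrite !exprMn -rmorphXn /= !root_power_order rmorph1 !mulr1.
case: forallP => [h _ i ci | _]; last by rewrite eqxx.
have := h i; rewrite ci expr0 mul1r mulrC => /eqP/root_power_inj.
by move=> ->.
Qed.

(** Fourier inversion in both arguments of the kernel: summing over [a] and over
    [b] each forces [t = s]. *)
Lemma gram_reconstruction (F : exponent m n -> R[i]) s :
  \sum_a \sum_b
    (\sum_t F t * ((monomial a (point t))^*%R * monomial b (point t)))
    * (monomial a (point s) * (monomial b (point s))^*%R)
  = F s * (m ^ n)%:R ^+ 2.
Proof.
transitivity (\sum_t F t *
  ((\sum_a monomial a (point s) * (monomial a (point t))^*%R) *
   (\sum_b monomial b (point t) * (monomial b (point s))^*%R))).
  under [RHS]eq_bigr => t _ do rewrite big_distrlr mulr_sumr.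
  rewrite [RHS]exchange_big; apply: eq_bigr => a _ /=.
  under [RHS]eq_bigr => t _ do rewrite mulr_sumr.
  rewrite [RHS]exchange_big; apply: eq_bigr => b _ /=.
  by rewrite mulr_suml; apply: eq_bigr => t _; ring.
rewrite (bigD1 s) //= [X in _ + X]big1 ?addr0 => [|t ts].
  by rewrite !monomial_sum_exponents eqxx expr2.
by rewrite !monomial_sum_exponents (negPf ts) mulr0n !mulr0.
Qed.

(** * The sum of squares *)

Variables (d : nat) (f : unit_roots_power R m n -> R).
Hypotheses (n_lt : (n < d.*2)%N) (f_ge0 : forall z, 0 <= f z)
  (f_span : supported_on (at_most_two_variables m n) (fun z => (f z)%:C)).

Definition weighted_character a t : R[i] :=
  sqrtC (f (point t))%:C * monomial a (point t).

Lemma inner_weighted_character a b :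
  inner (weighted_character a) (weighted_character b)
  = \sum_t (f (point t))%:C *
      ((monomial a (point t))^*%R * monomial b (point t)).
Proof.
apply: eq_bigr => t _; rewrite /weighted_character rmorphM /= mulrACA.
by rewrite geC0_conj ?sqrtC_ge0 ?ler0c // -expr2 sqrtCK.
Qed.

(** Expanding [f], a nonzero inner product needs a monomial of [f] whose exponent
    is [a - b]; such an exponent has at most two nonzero coordinates. *)
Lemma weighted_character_linked a b :
  inner (weighted_character a) (weighted_character b) != 0 -> linked d a b.
Proof.
rewrite inner_weighted_character => nz; apply: linked_hamming.
have [coef fE] := f_span; move: nz.
under eq_bigr => t _ do rewrite fE mulr_suml.
rewrite exchange_big /= => nz.
have [c cA] : exists2 c, c \in at_most_two_variables m n &
    \sum_t coef c * monomial c (point t) *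
      ((monomial a (point t))^*%R * monomial b (point t)) != 0.
  apply/exists_inP; apply: contraNT nz => /exists_inPn h.
  by apply/eqP/big1 => c cA; apply/eqP/negPn/h.
under eq_bigr => t _ do rewrite -mulrA.
rewrite -mulr_sumr mulf_eq0 negb_or => /andP[_ /monomial_triple_sum abE].
move: cA; rewrite inE; apply: leq_trans; apply/subset_leq_card/subsetP => i.
by rewrite !inE; apply: contraNneq => ci0; apply/eqP/abE/val_inj.
Qed.

(** The square attached to [v] is that of the combination of monomials given by
    the [v]-th Gram-Schmidt column, turned by a monomial of modulus one that
    moves the dominant value of [v] to 0. *)
Lemma sum_of_squares_bounded_counts :
  exists (r : nat) (g : 'I_r -> unit_roots_power R m n -> R[i]),
    (forall j, supported_on (bounded_counts m n d) (g j)) /\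
    (forall z, (f z)%:C = \sum_(j < r) g j z * conjc (g j z)).
Proof.
have [g [g_supp g_sum]] := sparse_gram_schmidt (linked_perfect n_lt) (S := setT)
  (U := weighted_character)
  (fun a b nz => introT and3P (And3 (in_setT a) (in_setT b)
     (weighted_character_linked nz))).
have /fin_all_exists[j j_rot] : forall v : exponent m n, exists j : 'I_m,
    forall a, (max_count a <= max_count v)%N -> linked d v a ->
    rotate_exponent j a \in bounded_counts m n d.
  by move=> v; apply: linked_rotate.
pose N : R[i] := (m ^ n)%:R.
have N_nz : N != 0 by rewrite pnatr_eq0 expn_eq0.
pose G v z := (monomial [ffun=> j v] z)^*%R *
  \sum_a (N^-1 * (g v a)^*%R) * monomial a z.
exists #|exponent m n|, (fun k => G (enum_val k)); split=> [k | z].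
  apply: supported_on_rotate => a; rewrite mulf_eq0 negb_or conjC_eq0.
  by case/andP=> _ /g_supp/andP[]; apply: j_rot.
have [s ->] := point_surj z.
rewrite -(big_enum_val (A := xpredT)
  (fun v => G v (point s) * conjc (G v (point s)))).
apply: (mulIf (expf_neq0 2 N_nz)).
rewrite -(gram_reconstruction (fun t => (f (point t))%:C)) /= mulr_suml.
under eq_bigr => a _ do under eq_bigr => b _ do
  rewrite -inner_weighted_character g_sum mulr_suml.
under eq_bigr => a _ do rewrite exchange_big.
rewrite exchange_big; apply: eq_big => [v | v _]; first by rewrite inE.
rewrite -[conjc _]/(_^*%R) /G rmorphM /= conjCK [X in X * N ^+ 2]mulrACA.
rewrite (mulrC _ (monomial [ffun=> j v] _)) monomial_conj mul1r.
rewrite rmorph_sum big_distrlr mulr_suml.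
apply: eq_bigr => a _; rewrite mulr_suml; apply: eq_bigr => b _ /=.
rewrite !rmorphM /= conjCK fmorphV /= conjC_nat -/N.
by field.
Qed.

End Monomials.

Theorem theorem4 (R : realType) (m n : nat) (hm : (2 <= m)%N) (hn : (1 <= n)%N)
    (f : unit_roots_power R m n -> R)
    (f_ge0 : forall z, 0 <= f z)
    (f_span : supported_on (at_most_two_variables m n) (fun z => (f z)%:C)) :
  exists (r : nat) (g : 'I_r -> unit_roots_power R m n -> R[i]),
    (forall j, supported_on (bounded_counts m n (n %/ 2 + 1)) (g j)) /\
    (forall z, (f z)%:C = \sum_(j < r) g j z * conjc (g j z)).
Proof.
case: m hm f f_ge0 f_span => // p _ f f_ge0 f_span.
have [w w_prim] := primitive_root_exists R p.
by apply: (sum_of_squares_bounded_counts w_prim _ f_ge0 f_span); lia.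
Qed.
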